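(* Consider an $N$-asset geometric mean market maker pool with zero fees and perfect arbitrage. At time $t_k$ it has weights $\mathbf w^{(k)}$ and is in no-arbitrage equilibrium at market prices $\mathbf P^{(k)}$, with value $V_k$. At time $t_{k+1}$ the weights are updated to $\mathbf w^{(k+1)}$, the market prices change to $\mathbf P^{(k+1)}$, and the pool is arbitraged to its new equilibrium, with value $V_{k+1}$. In the resulting factorisation of the value change $$\frac{V_{k+1}}{V_k}=r\cdot\prod_i\left(\frac{P_i^{(k+1)}}{P_i^{(k)}}\right)^{w_i^{(k+1)}},$$ the retention ratio $r$ is $$r=\prod_i\left(\frac{w_i^{(k)}}{w_i^{(k+1)}}\right)^{w_i^{(k+1)}},$$ which depends only on the weight change and not on the prices. In particular, the identity $-\log r=D_{\mathrm{KL}}(\mathbf w^{(k+1)}\,\|\,\mathbf w^{(k)})$ holds identically (for every price realisation) when prices follow driftless geometric Brownian motions.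
   Context: Weights are vectors in $\mathbb R^N$ with positive components summing to $1$; prices and reserves are vectors with positive components; $D_{\mathrm{KL}}(p\,\|\,q)=\sum_ip_i\log(p_i/q_i)$. A pool with weights $\mathbf w$ and reserves $\mathbf R$ has invariant $\prod_iR_i^{w_i}$ and value $V=\sum_iR_iP_i$ at market prices $\mathbf P$; it is in no-arbitrage equilibrium at $\mathbf P$ when $R_iP_i=w_iV$ for all $i$. Zero-fee arbitrage after a weight update takes the reserves $\mathbf R^{(k)}$ to reserves $\mathbf R^{(k+1)}$ that preserve the invariant at the new weights, $\prod_i(R_i^{(k+1)})^{w_i^{(k+1)}}=\prod_i(R_i^{(k)})^{w_i^{(k+1)}}$, and that are in equilibrium at the new prices with the new weights. Driftless geometric Brownian motion means $\mathrm dP_i/P_i=\sigma_i\,\mathrm dW_i$ with $W_i$ Brownian motions. *)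

(* Defs.v *)
From HB Require Import structures.
From mathcomp Require Import all_boot all_order all_algebra.
From mathcomp Require Import all_classical all_reals all_analysis.
Set Implicit Arguments.
Unset Strict Implicit.
Unset Printing Implicit Defensive.
Import Order.TTheory GRing.Theory Num.Theory.
Import numFieldNormedType.Exports.
Local Open Scope classical_set_scope.
Local Open Scope ring_scope.

Section Pool.
Context {R : realType} {N : nat}.
Implicit Types w p q P rs : 'rV[R]_N.

Definition positive_vector p : Prop := forall i, 0 < p 0 i.

Definition weight_vector w : Prop := positive_vector w /\ \sum_i w 0 i = 1.

Definition KL_divergence p q : R := \sum_i p 0 i * ln (p 0 i / q 0 i).

Definition pool_invariant w rs : R := \prod_i rs 0 i `^ w 0 i.

Definition pool_value rs P : R := \sum_i rs 0 i * P 0 i.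

Definition no_arbitrage_equilibrium w rs P : Prop :=
  forall i, rs 0 i * P 0 i = w 0 i * pool_value rs P.

(* The pool (w, rs) is in equilibrium at P; then the weights become w', the
   prices P', and zero-fee arbitrage brings the reserves to rs'. *)
Definition arbitraged_update w w' P P' rs rs' : Prop :=
  [/\ weight_vector w /\ weight_vector w',
      positive_vector P /\ positive_vector P',
      positive_vector rs /\ positive_vector rs',
      no_arbitrage_equilibrium w rs P
    & pool_invariant w' rs' = pool_invariant w' rs
      /\ no_arbitrage_equilibrium w' rs' P'].

Definition retention_ratio w' P P' rs rs' (r : R) : Prop :=
  pool_value rs' P' / pool_value rs P =
  r * \prod_i (P' 0 i / P 0 i) `^ w' 0 i.

End Pool.

(* Stochastic processes are functions X : R -> Omega -> R, of which only the
   values X t with 0 <= t are used. *)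
Section Brownian.
Context {R : realType} {d : measure_display} {Omega : measurableType d}.
Variable Pr : probability Omega R.
Implicit Types (F : R -> set (set Omega)) (X H W : R -> Omega -> R).

Definition filtration F : Prop :=
  [/\ forall t : R, 0 <= t -> sigma_algebra setT (F t),
      forall t : R, 0 <= t -> F t `<=` measurable
    & forall s t : R, 0 <= s -> s <= t -> F s `<=` F t].

Definition adapted F X : Prop :=
  forall t : R, 0 <= t ->
  forall B : set R, measurable B -> F t (X t @^-1` B).

Definition ae_continuous_paths X : Prop :=
  {ae Pr, forall om, {within [set t : R | 0 <= t], continuous (fun t => X t om)}}.

Definition brownian_motion F W : Prop :=
  [/\ adapted F W,
      {ae Pr, forall om, W 0 om = 0},
      forall s t : R, 0 <= s -> s < t ->
        forall (A : set Omega) (B : set R), F s A -> measurable B ->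
        Pr (A `&` (W t \- W s) @^-1` B) =
        (Pr A * Pr ((W t \- W s)%R @^-1` B))%E,
      forall s t : R, 0 <= s -> s < t ->
        forall B : set R, measurable B ->
        Pr ((W t \- W s) @^-1` B) =
        normal_prob 0 (Num.sqrt (t - s)) B
    & ae_continuous_paths W].

Definition partition_finer (t delta : R) (n : nat) (s : nat -> R) : Prop :=
  [/\ s 0%N = 0, s n = t,
      forall j, (j < n)%N -> s j <= s j.+1
    & forall j, (j < n)%N -> s j.+1 - s j < delta].

(* For H adapted with continuous paths, the Ito integral of H against W over
   [0, t] is the limit in probability of the left-endpoint Riemann sums as the
   mesh of the partition of [0, t] tends to 0. *)
Definition is_ito_integral H W (t : R) (I : Omega -> R) : Prop :=
  forall eps eta : R, 0 < eps -> 0 < eta ->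
  exists2 delta : R, 0 < delta &
    forall (n : nat) (s : nat -> R), partition_finer t delta n s ->
    (Pr [set om | (eps <= `|\sum_(j < n) H (s j) om
                             * (W (s j.+1) om - W (s j) om) - I om|)%R]
       < eta%:E)%E.

(* dP_i = sigma_i P_i dW_i in integral form. The W_i are Brownian motions for
   a common filtration; no assumption is made on their joint law. *)
Definition driftless_gbm {N : nat} F (sigma : 'I_N -> R)
    (W P : 'I_N -> R -> Omega -> R) : Prop :=
  filtration F /\
  forall i : 'I_N,
    [/\ brownian_motion F (W i),
        adapted F (P i),
        ae_continuous_paths (P i),
        forall (t : R) om, 0 <= t -> 0 < P i t om
      & forall t : R, 0 <= t ->
        is_ito_integral (fun u om => sigma i * P i u om) (W i) t
          (fun om => P i t om - P i 0 om)].

End Brownian.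

(* Main.v *)
Require Import Defs.
From HB Require Import structures.
From mathcomp Require Import all_boot all_order all_algebra.
From mathcomp Require Import all_classical all_reals all_analysis.
From mathcomp Require Import ring.
Import Order.TTheory GRing.Theory Num.Theory.
Import numFieldNormedType.Exports.
Local Open Scope classical_set_scope.
Local Open Scope ring_scope.

(** For each asset, equilibrium before and after gives V'/V = (R'_i/R_i)(w_i/w'_i)(P'_i/P_i). Take
    the geometric mean of these equations with weights w': the left side is unchanged since the w'_i
    sum to 1, and the reserve factors cancel because the invariant is preserved at w'
    ([arbitraged_pool_value]). What multiplies the price factor is a function of the weights alone,
    and minus its logarithm is the divergence term by term. All of this is pointwise, so it holds
    along every price realisation. *)

Section GeometricMean.
Context {R : realType}.

Lemma powR_sumr {I : finType} (a : R) (f : I -> R) : 0 < a ->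
  a `^ (\sum_i f i) = \prod_i a `^ f i.
Proof.
move=> a0; apply: (big_morph (fun x => a `^ x)); last exact: powRr0.
by move=> x y; rewrite powRD// (gt_eqF a0) implybT.
Qed.

Lemma ln_prod {I : finType} (f : I -> R) : (forall i, 0 < f i) ->
  ln (\prod_i f i) = \sum_i ln (f i).
Proof.
(* Positivity of the partial product is carried through the induction because [lnM] needs it. *)
move=> f0; suff [] : 0 < \prod_i f i /\ ln (\prod_i f i) = \sum_i ln (f i) by [].
apply: (big_rec2 (fun x y => 0 < x /\ ln x = y)) => [|i x y _ [y0 <-]].
  by rewrite ln1.
by rewrite lnM ?posrE ?mulr_gt0.
Qed.

End GeometricMean.

Section ArbitragedPool.
Context {R : realType} {N : nat}.
Implicit Types w P rs : 'rV[R]_N.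

Lemma pool_value_gt0 {w rs P} : weight_vector w ->
  positive_vector rs -> positive_vector P -> 0 < pool_value rs P.
Proof.
move=> [_ w1] rs0 P0; case: N w rs P w1 rs0 P0 => [|n] w rs P w1 rs0 P0.
  (* An empty pool would have value 0, but its weights would sum to 0 instead of 1. *)
  by move/eqP: w1; rewrite big_ord0 eq_sym oner_eq0.
rewrite /pool_value big_ord_recl ltr_pwDl ?mulr_gt0//.
by apply: sumr_ge0 => i _; rewrite ltW ?mulr_gt0.
Qed.

Definition weight_change_ratio w w' : R := \prod_i (w 0 i / w' 0 i) `^ w' 0 i.

Lemma arbitraged_pool_value {w w' P P' rs rs'} :
  arbitraged_update w w' P P' rs rs' ->
  pool_value rs' P' / pool_value rs P =
  weight_change_ratio w w' * \prod_i (P' 0 i / P 0 i) `^ w' 0 i.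
Proof.
move=> [[ww [w'0 w'1]] [P0 P'0] [rs0 rs'0] eq [inv eq']].
have V0 := pool_value_gt0 ww rs0 P0.
have V'0 := pool_value_gt0 (conj w'0 w'1) rs'0 P'0.
have w0 := ww.1.
have inv0 : pool_invariant w' rs != 0.
  by apply/prodf_neq0 => i _; rewrite gt_eqF ?powR_gt0.
(* The exponent 1 is written as the sum of the w'_i, which splits V'/V into one factor per asset. *)
rewrite -[LHS]powRr1 ?ltW ?divr_gt0// -[in LHS]w'1 powR_sumr ?divr_gt0//.
(* Equilibrium before and after makes each factor
   [V' / V = (rs' i / rs i) (w i / w' i) (P' i / P i)], and invariant
   preservation cancels the weighted product of the reserve ratios. *)
transitivity (\prod_i (rs' 0 i / rs 0 i) `^ w' 0 i
    * (weight_change_ratio w w' * \prod_i (P' 0 i / P 0 i) `^ w' 0 i)).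
  rewrite -!big_split /=; apply: eq_bigr => i _.
  rewrite -!powRM ?mulr_ge0 ?invr_ge0 ?ltW//; congr (_ `^ _).
  have -> : pool_value rs P = rs 0 i * P 0 i / w 0 i.
    by rewrite eq mulrC mulKf ?gt_eqF.
  have -> : pool_value rs' P' = rs' 0 i * P' 0 i / w' 0 i.
    by rewrite eq' mulrC mulKf ?gt_eqF.
  by field; rewrite !gt_eqF.
suff -> : \prod_i (rs' 0 i / rs 0 i) `^ w' 0 i = 1 by rewrite mul1r.
(* Multiplying by the old reserves' invariant at w' turns the claim into [inv]. *)
apply: (mulIf inv0); rewrite mul1r -[RHS]inv -big_split /=.
by apply: eq_bigr => i _; rewrite -powRM ?divr_ge0 ?ltW// divfK ?gt_eqF.
Qed.

(** The price factor is positive, so it cancels and the factorisation determines [r]. *)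
Lemma retention_ratioE {w w' P P' rs rs'} : arbitraged_update w w' P P' rs rs' ->
  forall r, retention_ratio w' P P' rs rs' r <-> r = weight_change_ratio w w'.
Proof.
move=> upd r; rewrite /retention_ratio (arbitraged_pool_value upd).
have [_ [P0 P'0] _ _ _] := upd.
have prices0 : \prod_i (P' 0 i / P 0 i) `^ w' 0 i != 0.
  by apply/prodf_neq0 => i _; rewrite gt_eqF ?powR_gt0 ?divr_gt0.
by split=> [/(mulIf prices0)|->].
Qed.

Lemma ln_weight_change_ratio w w' : positive_vector w -> positive_vector w' ->
  - ln (weight_change_ratio w w') = KL_divergence w' w.
Proof.
move=> w0 w'0; rewrite ln_prod => [|i]; last by rewrite powR_gt0 ?divr_gt0.
rewrite -sumrN; apply: eq_bigr => i _.
by rewrite ln_powR -mulrN -lnV ?posrE ?divr_gt0// invf_div.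
Qed.

End ArbitragedPool.

Theorem proposition3 (R : realType) (N : nat) :
  (forall w w' P P' rs rs' : 'rV[R]_N,
     arbitraged_update w w' P P' rs rs' ->
     forall r : R,
       retention_ratio w' P P' rs rs' r <->
       r = \prod_i (w 0 i / w' 0 i) `^ w' 0 i)
  /\
  (forall w w' P P' rs rs' Q Q' ss ss' : 'rV[R]_N,
     arbitraged_update w w' P P' rs rs' ->
     arbitraged_update w w' Q Q' ss ss' ->
     forall r s : R,
       retention_ratio w' P P' rs rs' r ->
       retention_ratio w' Q Q' ss ss' s ->
       r = s)
  /\
  (forall (d : measure_display) (Omega : measurableType d)
      (Pr : probability Omega R) (F : R -> set (set Omega))
      (sigma : 'I_N -> R) (W P : 'I_N -> R -> Omega -> R),
     driftless_gbm Pr F sigma W P ->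
     forall (t0 t1 : R), 0 <= t0 -> t0 < t1 ->
     forall (om : Omega) (w w' rs rs' : 'rV[R]_N),
       arbitraged_update w w' (\row_i P i t0 om) (\row_i P i t1 om) rs rs' ->
       forall r : R,
         retention_ratio w' (\row_i P i t0 om) (\row_i P i t1 om) rs rs' r ->
         - ln r = KL_divergence w' w).
Proof.
split; first by move=> w w' P P' rs rs' /retention_ratioE.
split=> [w w' P P' rs rs' Q Q' ss ss' updP updQ r s|].
  by move=> /(retention_ratioE updP) -> /(retention_ratioE updQ) ->.
move=> d Omega Pr F sigma W P _ t0 t1 _ _ om w w' rs rs' upd r.
move=> /(retention_ratioE upd) ->.
by have [[[w0 _] [w'0 _]] _ _ _ _] := upd; exact: ln_weight_change_ratio.
Qed.
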